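(* Let $X\subset\mathbb{R}^n$ be a closed, unbounded and convex set, let $I=\{1,\ldots,m\}$, let $\alpha>0$, and let $f=(f_1,\ldots,f_m):\mathbb{R}^n\to\mathbb{R}^m$ be an $\mathbb{R}^m_+$-$\alpha$-robustly quasiconvex mapping such that each $f_i:\mathbb{R}^n\to\mathbb{R}$ is lower semicontinuous. If the following conditions hold: (a) $\mathrm{Sol}^w(0)$ is a singleton; (b) $X^\infty\cap\big(\bigcup_{i\in I}\mathcal{K}_q(f_i)\big)=\{0\}$; then the set-valued mapping $\mathrm{Sol}^w(\cdot):\mathbb{R}^{m\times n}\rightrightarrows\mathbb{R}^n$ is lower semicontinuous at $0$. Conversely, if $\mathrm{Sol}^w(\cdot)$ is lower semicontinuous at $0$, then $$X^\infty\cap\Big(\bigcap_{i\in I}\mathcal{K}_q(f_i)\Big)=\{0\}.$$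
   Context: All spaces are Euclidean. For $u=(u_1,\ldots,u_m)\in\mathbb{R}^{m\times n}$ with $u_i\in\mathbb{R}^n$, put $\|u\|:=\max_{i\in I}\|u_i\|$ and $\langle u,x\rangle:=(\langle u_1,x\rangle,\ldots,\langle u_m,x\rangle)$. A mapping $g=(g_1,\ldots,g_m):\mathbb{R}^n\to\mathbb{R}^m$ is $\mathbb{R}^m_+$-quasiconvex if for every $y\in\mathbb{R}^m$ the set $\{x\in\mathbb{R}^n: g_i(x)\le y_i,\ i=1,\ldots,m\}$ is convex (equivalently, each $g_i$ is quasiconvex). $f$ is $\mathbb{R}^m_+$-$\alpha$-robustly quasiconvex if $x\mapsto f(x)+\langle u,x\rangle$ is $\mathbb{R}^m_+$-quasiconvex for all $u\in\mathbb{R}^{m\times n}$ with $\|u\|<\alpha$. $f^u(x):=f(x)-\langle u,x\rangle$, with components $f_i^{u_i}(x)=f_i(x)-\langle u_i,x\rangle$. $\mathrm{Sol}^w(u)$ is the set of weak Pareto solutions of minimizing $f^u$ over $X$, i.e., of all $\bar x\in X$ such that there is no $x\in X$ with $f_i^{u_i}(x)<f_i^{u_i}(\bar x)$ for all $i\in I$. Asymptotic cone: $X^\infty:=\{d\in\mathbb{R}^n:\exists\, t_k\to+\infty,\ \exists\, x_k\in X,\ x_k/t_k\to d\}$. $q$-asymptotic function of $\varphi:\mathbb{R}^n\to\mathbb{R}$: $\varphi_q^\infty(d):=\sup_{x\in\mathbb{R}^n}\sup_{t>0}\frac{\varphi(x+td)-\varphi(x)}{t}$. $\mathcal{K}_q(\varphi):=\{d\in\mathbb{R}^n:\varphi_q^\infty(d)\le0\}$.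 A set-valued mapping $F$ is lower semicontinuous at $\bar u$ if $F(\bar u)\neq\emptyset$ and for every open set $V$ with $F(\bar u)\cap V\neq\emptyset$ there is a neighborhood $U$ of $\bar u$ such that $F(u)\cap V\neq\emptyset$ for all $u\in U$. *)

(* Defs.v *)
From HB Require Import structures.
From mathcomp Require Import all_boot all_order all_algebra.
From mathcomp Require Import all_classical all_reals all_analysis.

Set Implicit Arguments.
Unset Strict Implicit.
Unset Printing Implicit Defensive.

Import Order.TTheory GRing.Theory Num.Theory.
Import numFieldNormedType.Exports.

Local Open Scope classical_set_scope.
Local Open Scope ring_scope.

(* R^n is ['rV[R]_n] and R^(m x n) is ['M[R]_(m, n)], the component u_i of u
   being its i-th row. The norm that the library puts on matrices is the maximum
   of the absolute values of the entries; it is used only through the topology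
   and the bounded sets, for which it agrees with the Euclidean norm. Where the
   value of the norm matters, [enorm] and [mnorm] are used. *)

Section Euclidean.
Context {R : realType} {m n : nat}.

Definition dotp (v x : 'rV[R]_n) : R := \sum_j v 0 j * x 0 j.

Definition enorm (v : 'rV[R]_n) : R := Num.sqrt (dotp v v).

Definition mnorm (u : 'M[R]_(m, n)) : R := \big[Num.max/0]_i enorm (row i u).

Definition mdotp (u : 'M[R]_(m, n)) (x : 'rV[R]_n) : 'rV[R]_m :=
  \row_i dotp (row i u) x.

End Euclidean.

Section Quasiconvexity.
Context {R : realType} {m n : nat}.

Definition quasiconvex_map (g : 'rV[R]_n -> 'rV[R]_m) : Prop :=
  forall y : 'rV[R]_m, convex_set [set x | forall i, g x 0 i <= y 0 i].

Definition robustly_quasiconvex (alpha : R) (f : 'rV[R]_n -> 'rV[R]_m) : Prop :=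
  forall u : 'M[R]_(m, n), mnorm u < alpha ->
    quasiconvex_map (fun x => f x + mdotp u x).

End Quasiconvexity.

Section WeakPareto.
Context {R : realType} {m n : nat}.

Definition weak_pareto (X : set 'rV[R]_n) (g : 'rV[R]_n -> 'rV[R]_m)
    : set 'rV[R]_n :=
  [set xbar | X xbar /\ ~ exists2 x, X x & forall i, g x 0 i < g xbar 0 i].

Definition perturb (f : 'rV[R]_n -> 'rV[R]_m) (u : 'M[R]_(m, n))
    : 'rV[R]_n -> 'rV[R]_m :=
  fun x => f x - mdotp u x.

Definition Solw (X : set 'rV[R]_n) (f : 'rV[R]_n -> 'rV[R]_m)
    (u : 'M[R]_(m, n)) : set 'rV[R]_n :=
  weak_pareto X (perturb f u).

End WeakPareto.

Section Asymptotic.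
Context {R : realType} {n : nat}.

Definition asymptotic_cone (X : set 'rV[R]_n) : set 'rV[R]_n :=
  [set d : 'rV[R]_n | exists (t : nat -> R) (x : nat -> 'rV[R]_n),
    [/\ t k @[k --> \oo] --> +oo, forall k, X (x k)
      & (t k)^-1 *: x k @[k --> \oo] --> d]].

Definition q_asymptotic (phi : 'rV[R]_n -> R) (d : 'rV[R]_n) : \bar R :=
  ereal_sup [set ereal_sup
    [set ((phi (x + t *: d) - phi x) / t)%:E | t in [set t | 0 < t]]
    | x in [set: 'rV[R]_n]].

Definition Kq (phi : 'rV[R]_n -> R) : set 'rV[R]_n :=
  [set d | (q_asymptotic phi d <= 0)%E].

End Asymptotic.

Definition setvalued_lsc_at {S T : topologicalType} (F : S -> set T) (ubar : S)
    : Prop :=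
  F ubar !=set0 /\
  forall V : set T, open V -> F ubar `&` V !=set0 ->
    exists2 U, nbhs ubar U & forall u, U u -> F u `&` V !=set0.

(* Main.v *)
Require Import Defs.
From HB Require Import structures.
From mathcomp Require Import all_boot all_order all_algebra.
From mathcomp Require Import all_classical all_reals all_analysis.
From mathcomp Require Import ring lra.

Set Implicit Arguments.
Unset Strict Implicit.
Unset Printing Implicit Defensive.

Import Order.TTheory GRing.Theory Num.Theory.
Import numFieldNormedType.Exports.

Local Open Scope classical_set_scope.
Local Open Scope ring_scope.

(** Why the result holds.

    For the direct part it is enough to look at one component [phi] of [f]: a
    minimizer over [X] of [phi - <v, .>], where [v] is the corresponding row of
    [u], is a weak Pareto solution of the perturbed problem ([Solw_argmin]). So
    lower semicontinuity follows once, for [v] near 0, such a minimizer exists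
    and lies close to the unique solution [xbar].

    The heart is [Kq_escape]. Let [u_k] tend to 0 and let points [x_k] escape
    to infinity in the direction [d] while [phi - <u_k, .>] is at most its value
    at a fixed [y]. Then [d] belongs to [Kq phi]. By quasiconvexity the
    segments from [y] to [x_k] lie in the perturbed level sets, and lower
    semicontinuity shows in the limit that [phi] is bounded on the ray from [y]
    in the direction [d]. Then every level set that is high enough is closed and
    convex and contains a ray of direction [d], hence contains the ray of
    direction [d] from each of its points: [phi] is bounded on all of these
    rays. Robustness now enters: if [phi] rises at all along a ray, then
    subtracting a small multiple of [<d, .>] keeps a rise, quasiconvexity
    propagates the rise to infinity, and so [phi] grows at least linearly on that
    ray ([ray_rise_unbounded]). A bounded ray is therefore nonincreasing, which
    is membership in [Kq phi] ([Kq_bounded_ray]).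

    Since no nonzero direction is both asymptotic to [X] and in [Kq phi],
    compactness of the unit sphere gives one bound for the level sets of all
    small perturbations over [X] ([level_bounded]). Existence of minimizers
    follows ([argmin_near]), and a second compactness argument confines the
    perturbed level sets of [xbar] to a given neighbourhood of [xbar]
    ([level_localized]), because [xbar] is the only minimizer of [phi] on [X].

    For the converse, a nonzero direction [d] asymptotic to [X] and common to
    all [Kq] would allow moving along [d] inside [X] from any point without
    increasing any [f_i]. When every row of [u] is [e d] with [e > 0], such a
    move strictly decreases every perturbed component, so there is no weak
    Pareto solution, for [u] as small as one likes. *)

(** * Scalar product *)

Section DotProduct.
Context {R : realType} {n : nat}.
Implicit Types (v x y : 'rV[R]_n) (a : R).

Lemma dotpDr v x y : dotp v (x + y) = dotp v x + dotp v y.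
Proof. by rewrite -big_split; apply: eq_bigr => j _; rewrite !mxE mulrDr. Qed.

Lemma dotpZr v a x : dotp v (a *: x) = a * dotp v x.
Proof. by rewrite mulr_sumr; apply: eq_bigr => j _; rewrite !mxE mulrCA. Qed.

Lemma dotpZl a v x : dotp (a *: v) x = a * dotp v x.
Proof. by rewrite mulr_sumr; apply: eq_bigr => j _; rewrite !mxE mulrA. Qed.

Lemma dotp0l x : dotp 0 x = 0.
Proof. by rewrite -(scale0r 0) dotpZl mul0r. Qed.

Lemma dotpNl v x : dotp (- v) x = - dotp v x.
Proof. by rewrite -scaleN1r dotpZl mulN1r. Qed.

Lemma dotpNr v x : dotp v (- x) = - dotp v x.
Proof. by rewrite -scaleN1r dotpZr mulN1r. Qed.

Lemma dotp_gt0 x : x != 0 -> 0 < dotp x x.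
Proof.
move=> x0; rewrite lt_neqAle sumr_ge0 ?andbT; last first.
  by move=> j _; rewrite -expr2 sqr_ge0.
apply: contra x0; rewrite eq_sym psumr_eq0; last first.
  by move=> j _; rewrite -expr2 sqr_ge0.
move=> /allP x0; apply/eqP/rowP => j; rewrite mxE; apply/eqP.
by have := x0 j; rewrite mem_index_enum -expr2 sqrf_eq0; apply.
Qed.

Lemma cvg_dotp {T : Type} {F : set_system T} {FF : Filter F}
    (v x : T -> 'rV[R]_n) v0 x0 :
  v k @[k --> F] --> v0 -> x k @[k --> F] --> x0 ->
  dotp (v k) (x k) @[k --> F] --> dotp v0 x0.
Proof.
move=> vv0 xx0; rewrite /dotp.
apply: cvg_big => [|j _]; first exact: add_continuous.
apply: cvgM.
  exact: cvg_comp vv0 (@coord_continuous R 1 n 0 j v0).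
exact: cvg_comp xx0 (@coord_continuous R 1 n 0 j x0).
Qed.

Lemma dotp_continuous v : continuous (dotp v).
Proof.
move=> x; apply: (@cvg_dotp _ (nbhs x) _ (fun=> v) id) => //.
exact: cvg_cst.
Qed.

Lemma cvg_enorm0 : enorm v @[v --> (0 : 'rV[R]_n)] --> 0.
Proof.
rewrite -[X in _ --> X]sqrtr0 -(dotp0l 0).
have dotp_cvg0 : dotp v v @[v --> (0 : 'rV[R]_n)] --> dotp 0 (0 : 'rV[R]_n).
  have vcvg0 : v @[v --> (0 : 'rV[R]_n)] --> (0 : 'rV[R]_n) by exact: cvg_id.
  exact: (cvg_dotp vcvg0 vcvg0).
exact: cvg_comp dotp_cvg0 (@sqrt_continuous R _).
Qed.

End DotProduct.

(** * Convex sets and asymptotic directions *)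

Section Convexity.
Context {R : realType} {n : nat}.
Implicit Types (C : set 'rV[R]_n) (x y d : 'rV[R]_n).

Lemma convE x y (s : {i01 R}) :
  conv s (y : convex_lmodType 'rV[R]_n) (x : convex_lmodType 'rV[R]_n) =
  x + s%:num *: (y - x).
Proof. by rewrite /conv/= /unstable.onem scalerBl scale1r scalerBr addrCA. Qed.

Lemma convex_setP C : convex_set C <->
  forall x y s, C x -> C y -> 0 <= s <= 1 -> C (x + s *: (y - x)).
Proof.
split=> [cC x y s Cx Cy /andP[s0 s1]|cC y x s]; last first.
  by rewrite !inE convE => Cy Cx; apply: cC; rewrite // ge0 le1.
by have := cC y x (Itv01 s0 s1); rewrite !inE convE => /(_ Cy Cx).
Qed.

End Convexity.

Section Escape.
Context {R : realType} {n : nat} {T : Type} {F : set_system T}.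
Context {FF : ProperFilter F}.
Variables (t : T -> R) (x : T -> 'rV[R]_n) (d : 'rV[R]_n).
Hypotheses (toy : t k @[k --> F] --> +oo)
  (xd : (t k)^-1 *: x k @[k --> F] --> d).

Lemma cvg_div0 s : s / t k @[k --> F] --> 0.
Proof.
rewrite -[X in _ --> X](mulr0 s); apply: cvgM; first exact: cvg_cst.
by apply/gtr0_cvgV0 => //; exact: cvgry_gt.
Qed.

(** The points [x k] escape to infinity, yet the segments from [y] to [x k]
    approximate the ray of direction [d] point by point: the parameter [s / t k]
    keeps the distance travelled from [y] bounded. *)
Lemma cvg_escape y s : y + (s / t k) *: (x k - y) @[k --> F] --> y + s *: d.
Proof.
have -> : (fun k => y + (s / t k) *: (x k - y)) =
          (fun k => y + (s *: ((t k)^-1 *: x k) - (s / t k) *: y)).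
  by apply/funext => k; rewrite scalerBr scalerA.
have -> : y + s *: d = y + (s *: d - 0 *: y) by rewrite scale0r subr0.
apply: cvgD; first exact: cvg_cst.
apply: cvgB; first by apply: cvgZ => //; exact: cvg_cst.
by apply: cvgZ; [exact: cvg_div0|exact: cvg_cst].
Qed.

Lemma near_div01 s : 0 <= s -> \forall k \near F, 0 <= s / t k <= 1.
Proof.
move=> s0; near=> k; have tk : 0 < t k by near: k; exact: cvgry_gt.
rewrite divr_ge0 ?(ltW tk)//= ler_pdivrMr// mul1r.
near: k; exact: cvgry_ge.
Unshelve. all: by end_near. Qed.

(** Stated for an arbitrary filter, because it serves both for the sequences in
    the definition of the asymptotic cone and for the filter of escaping points
    built in [level_bounded]. *)
Lemma closed_convex_escape (C : set 'rV[R]_n) y s : closed C -> convex_set C ->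
  (\forall k \near F, C (x k)) -> C y -> 0 <= s -> C (y + s *: d).
Proof.
move=> clC cC Cx Cy s0; apply: closed_cvg clC _ _ (cvg_escape (y := y) (s := s)).
near=> k; apply: (convex_setP C).1 => //; first by near: k.
by near: k; exact: near_div01.
Unshelve. all: by end_near. Qed.

End Escape.

Section AsymptoticCone.
Context {R : realType} {n : nat}.
Implicit Types (C : set 'rV[R]_n) (x y d : 'rV[R]_n).

Lemma asymptotic_cone_ray C y d :
  (forall s, 0 <= s -> C (y + s *: d)) -> asymptotic_cone C d.
Proof.
move=> Cyd; exists (fun k => k.+1%:R), (fun k => y + k.+1%:R *: d); split => //.
- by apply/cvgrnyP; exact: (cvg_addnl 1).
- by move=> k; exact: Cyd.
- have -> : (fun k => k.+1%:R^-1 *: (y + k.+1%:R *: d)) =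
            (fun k => k.+1%:R^-1 *: y + d).
    by apply/funext => k; rewrite scalerDr scalerA mulVf ?pnatr_eq0// scale1r.
  rewrite -[X in _ --> X]add0r -(scale0r y).
  apply: cvgD; last exact: cvg_cst.
  apply: cvgZ; last exact: cvg_cst.
  exact: cvg_harmonic.
Qed.

(** With [asymptotic_cone_ray]: a closed convex set that contains one ray of
    direction [d] contains such a ray from each of its points. *)
Lemma asymptotic_cone_recession C y d s : closed C -> convex_set C ->
  asymptotic_cone C d -> C y -> 0 <= s -> C (y + s *: d).
Proof.
move=> clC cC [t [x [toy Cx xd]]] Cy s0.
by apply: (closed_convex_escape toy xd) => //; near=> k; exact: Cx.
Unshelve. all: by end_near. Qed.

End AsymptoticCone.

(** * Lower semicontinuous functions *)

Section LowerSemicontinuity.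
Context {R : realType} {n : nat} (phi : 'rV[R]_n -> R).
Hypothesis lscphi : lower_semicontinuous (EFin \o phi).
Implicit Types (x y d : 'rV[R]_n).

Lemma lsc_near x r : r < phi x -> \forall y \near x, r < phi y.
Proof.
move=> rx; have [|V Vx Vr] := @lscphi x r; first by rewrite lte_fin.
by apply: filterS Vx => y /Vr; rewrite lte_fin.
Qed.

Lemma lsc_closed r : closed [set x | phi x <= r].
Proof.
rewrite -[X in closed X]setCK; apply: open_closedC.
rewrite openE => x /= /negP; rewrite -ltNge => /lsc_near.
by apply: filterS => y ry; apply/negP; rewrite -ltNge.
Qed.

Lemma lsc_cvg_le {T : Type} {F : set_system T} {FF : ProperFilter F}
    (z : T -> 'rV[R]_n) (c : T -> R) z0 c0 :
  z k @[k --> F] --> z0 -> c k @[k --> F] --> c0 ->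
  (\forall k \near F, phi (z k) <= c k) -> phi z0 <= c0.
Proof.
move=> zz cc le_zc; rewrite leNgt; apply/negP => ltc.
pose r := (c0 + phi z0) / 2.
have rz : \forall y \near z0, r < phi y by apply: lsc_near; rewrite /r; lra.
have cr : c0 < r by rewrite /r; lra.
suff /filter_ex[k []//] : \forall k \near F, False.
near=> k.
have : r < phi (z k) by near: k; exact: (zz _ rz).
have : c k < r by near: k; exact: (cvgr_lt _ cc).
have : phi (z k) <= c k by near: k.
by lra.
Unshelve. all: by end_near. Qed.

(** The sets [B z] of points that do at least as well as [z] form a filter base
    on the compact set; by lower semicontinuity a cluster point of that filter
    beats every [z]. *)
Lemma lsc_argmin (K : set 'rV[R]_n) : compact K -> K !=set0 ->
  exists2 x, K x & forall y, K y -> phi x <= phi y.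
Proof.
move=> cK K0.
pose B z := [set y | K y /\ phi y <= phi z].
have FB : ProperFilter (filter_from K B).
  apply: filter_from_proper => [|z Kz]; last by exists z; split.
  apply: filter_from_filter => // y z Ky Kz.
  have [yz|zy] := leP (phi y) (phi z).
    by exists y => // w [Kw wy]; split; split => //; exact: le_trans yz.
  by exists z => // w [Kw wz]; split; split => //; exact: le_trans (ltW zy).
have [|x [Kx clx]] := cK _ FB.
  by have [z Kz] := K0; exists z => // w [].
exists x => // y Ky; rewrite leNgt; apply/negP => /lsc_near yx.
have [|w [[_ wy]]] := clx (B y) _ _ yx; first by exists y.
by rewrite ltNge wy.
Qed.

End LowerSemicontinuity.

(** * Robustly quasiconvex functions along rays *)

Section QAsymptotic.
Context {R : realType} {n : nat}.
Implicit Types (phi : 'rV[R]_n -> R) (x d : 'rV[R]_n).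

Lemma KqP phi d :
  Kq phi d <-> forall x t, 0 < t -> phi (x + t *: d) <= phi x.
Proof.
split=> [Kd x t t0|dec].
  have : (((phi (x + t *: d) - phi x) / t)%:E <= 0)%E.
    apply: le_trans Kd; apply: le_trans; last first.
      by apply: ereal_sup_ubound; exists x.
    by apply: ereal_sup_ubound; exists t.
  by rewrite lee_fin ler_pdivrMr// mul0r subr_le0.
apply: ge_ereal_sup => _ [x _ <-]; apply: ge_ereal_sup => _ [t /= t0 <-].
by rewrite lee_fin ler_pdivrMr// mul0r subr_le0 dec.
Qed.

Definition quasiconvex phi := forall r, convex_set [set x | phi x <= r].

Lemma quasiconvex_max phi x y s : quasiconvex phi -> 0 <= s <= 1 ->
  phi (x + s *: (y - x)) <= Num.max (phi x) (phi y).
Proof.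
move=> qphi s01; apply: ((convex_setP _).1 (qphi _)) => //=.
  by rewrite le_max lexx.
by rewrite le_max lexx orbT.
Qed.

End QAsymptotic.

Lemma compact_truncation {R : realType} {n : nat} (X : set 'rV[R]_n) M :
  closed X -> compact (X `&` [set x | `|x| <= M]).
Proof.
move=> clX; apply: bounded_closed_compact.
  exists M; split=> [|r Mr x [_ /= xM]]; first exact: num_real.
  exact: le_trans (ltW Mr).
apply: closedI => //.
apply: (@preimage_closed _ _ (fun d : 'rV[R]_n => `|d|) [set r | r <= M]).
  by move=> d _; exact: norm_continuous.
exact: closed_le.
Qed.

Section RobustScalar.
Context {R : realType} {n : nat} (phi : 'rV[R]_n -> R).
Hypothesis lscphi : lower_semicontinuous (EFin \o phi).
Hypothesis qcphi :
  \forall v \near (0 : 'rV[R]_n), quasiconvex (fun x => phi x - dotp v x).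
Implicit Types (x y d u : 'rV[R]_n).

Lemma robust_quasiconvex : quasiconvex phi.
Proof.
have := nbhs_singleton qcphi; congr quasiconvex.
by apply/funext => x; rewrite dotp0l subr0.
Qed.

(** The growth is at least linear: for some small [e > 0] the function
    [phi - e <d, .>] still rises between [x] and [x + t d], so by
    quasiconvexity it stays above its value at [x] beyond that point, and [phi]
    regains [e <d, d>] per unit step. Plain quasiconvexity would not do, as
    the bounded function [arctan] shows. *)
Lemma ray_rise_unbounded x d t r : 0 < t -> phi x < phi (x + t *: d) ->
  exists2 s, 0 <= s & r < phi (x + s *: d).
Proof.
move=> t0 rise.
have d0 : d != 0.
  by apply/eqP => d0; move: rise; rewrite d0 scaler0 addr0 ltxx.
pose D := dotp d d; have D0 : 0 < D by exact: dotp_gt0.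
have tD0 : 0 < t * D by exact: mulr_gt0.
have ed0 : e *: d @[e --> (0 : R)^'+] --> (0 : 'rV[R]_n).
  rewrite -(scale0r d); apply: cvgZ; last exact: cvg_cst.
  exact: cvg_within.
have [e [e0 qe small]] : exists e, [/\ 0 < e,
    quasiconvex (fun x => phi x - dotp (e *: d) x)
    & e * (t * D) < phi (x + t *: d) - phi x].
  apply/(@filter_ex _ (0 : R)^'+); near=> e; split => //.
  - by near: e; exact: (ed0 _ qcphi).
  - rewrite -ltr_pdivlMr//; near: e; apply: nbhs_right_lt.
    by rewrite divr_gt0// subr_gt0.
(* Far enough for the linear gain [e s D] to exceed [r - phi x], and at least
   [t], so that [x + t d] lies between [x] and [x + s d]. *)
pose s := t + `|r - phi x| / (e * D).
have eD0 : 0 < e * D by exact: mulr_gt0.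
have ts : t <= s by rewrite lerDl divr_ge0// ltW.
have s0 : 0 < s by exact: lt_le_trans ts.
have seD : e * s * D = e * (t * D) + `|r - phi x|.
  by rewrite /s; field; rewrite !gt_eqF.
exists s; first exact: ltW.
have s01 : 0 <= t / s <= 1.
  by rewrite divr_ge0 ?(ltW t0) ?(ltW s0)//= ler_pdivrMr// mul1r.
have := quasiconvex_max x (x + s *: d) qe s01.
rewrite [x + s *: d - x]addrC addKr scalerA divfK ?gt_eqF//.
rewrite !dotpZl !dotpDr !dotpZr -/D le_max => /orP[]; first by nra.
have := ler_norm (r - phi x); nra.
Unshelve. all: by end_near. Qed.

(** The bound on a single ray passes to all parallel rays, starting anywhere in
    the space: a level set that contains both the ray and [x] contains the ray
    from [x]. Boundedness then excludes any rise. *)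
Lemma Kq_bounded_ray y d r :
  (forall s, 0 <= s -> phi (y + s *: d) <= r) -> Kq phi d.
Proof.
move=> ler; apply/KqP => x t t0; rewrite leNgt; apply/negP => rise.
pose b := Num.max r (phi x).
have [s s0] := ray_rise_unbounded b t0 rise; rewrite ltNge => /negP; apply.
apply: (asymptotic_cone_recession (lsc_closed lscphi (r := b))) => //=.
- exact: robust_quasiconvex.
- by apply: (asymptotic_cone_ray (y := y)) => s' s'0 /=; rewrite le_max ler.
- by rewrite le_max lexx orbT.
Qed.

(** A direction in which perturbed level sets escape to infinity, while the
    perturbation vanishes, is a direction of decrease of [phi] itself. *)
Lemma Kq_escape {T : Type} {F : set_system T} {FF : ProperFilter F}
    (u : T -> 'rV[R]_n) (t : T -> R) (x : T -> 'rV[R]_n) y d :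
  u k @[k --> F] --> (0 : 'rV[R]_n) -> t k @[k --> F] --> +oo ->
  (t k)^-1 *: x k @[k --> F] --> d ->
  (\forall k \near F, phi (x k) - dotp (u k) (x k) <= phi y - dotp (u k) y) ->
  Kq phi d.
Proof.
move=> u0 toy xd lexy; apply: (@Kq_bounded_ray y d (phi y)) => s s0.
pose z k := y + (s / t k) *: (x k - y).
have zd : z k @[k --> F] --> y + s *: d by exact: cvg_escape.
apply: (lsc_cvg_le lscphi (c := fun k =>
  phi y - dotp (u k) y + dotp (u k) (z k)) zd).
  rewrite -[X in _ --> X]addr0 -[X in _ --> _ + X](dotp0l (y + s *: d)).
  apply: cvgD; last exact: cvg_dotp.
  rewrite -[X in _ --> X]subr0 -[X in _ --> _ - X](dotp0l y).
  by apply: cvgB; [exact: cvg_cst|apply: cvg_dotp => //; exact: cvg_cst].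
near=> k; rewrite -lerBlDr.
have qk : quasiconvex (fun x => phi x - dotp (u k) x).
  by near: k; exact: (u0 _ qcphi).
have sk : 0 <= s / t k <= 1 by near: k; exact: near_div01.
apply: le_trans (quasiconvex_max y (x k) qk sk) _.
by rewrite ge_max lexx /=; near: k.
Unshelve. all: by end_near. Qed.

Lemma lsc_perturb u : lower_semicontinuous (EFin \o (fun x => phi x - dotp u x)).
Proof.
move=> x a; rewrite lte_fin => ax.
pose r := (a + dotp u x + phi x) / 2.
exists [set z | r < phi z /\ dotp u z < r - a]; last first.
  by move=> z [rz uz]; rewrite lte_fin; lra.
have rx : \forall z \near x, r < phi z by apply: lsc_near => //; rewrite /r; lra.
have ux : dotp u z @[z --> x] --> dotp u x.
  exact: dotp_continuous.
have ra : dotp u x < r - a by rewrite /r; lra.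
near=> z; split; near: z; [exact: rx|exact: (cvgr_lt _ ux)].
Unshelve. all: by end_near. Qed.

(** * Minimizers of perturbed functions *)

Variable X : set 'rV[R]_n.
Hypotheses (closedX : closed X) (convexX : convex_set X).
Hypothesis KqX : forall d, asymptotic_cone X d -> Kq phi d -> d = 0.

(** One bound serves all small perturbations. Writing the points as [r d] with
    [d] on the unit sphere, it is enough, by compactness of the sphere, that for
    each [d] no point [r d'] of [X] satisfies the level inequality when [d'] is
    near [d], [r] is large and [u] is near 0. Otherwise such points escape in the direction
    [d], which is then both asymptotic to [X] and in [Kq phi]. *)
Lemma level_bounded y : X y ->
  exists M, \forall u \near (0 : 'rV[R]_n), forall x, X x ->
    phi x - dotp u x <= phi y - dotp u y -> `|x| <= M.
Proof.
move=> Xy.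
have /compact_near_coveringP cS : compact [set d : 'rV[R]_n | `|d| = 1].
  apply: bounded_closed_compact.
    by exists 1; split=> // M M1 d /= ->; exact: ltW.
  apply: (@preimage_closed _ _ (fun d : 'rV[R]_n => `|d|) [set 1]).
    by move=> d _; exact: norm_continuous.
  exact: closed_eq.
pose P (p : 'rV[R]_n * R) (d : 'rV[R]_n) := X (p.2 *: d) ->
  phi y - dotp p.1 y < phi (p.2 *: d) - dotp p.1 (p.2 *: d).
have [|[U W] /= [U0 [M [_ MW]]] UW] :=
    cS _ (filter_prod (nbhs (0 : 'rV[R]_n)) (pinfty_nbhs R)) P _.
  move=> d /= d1; apply: contrapT => nP.
  (* If the property fails near [d], the triples [(d', (u, r))] that violate it
     still meet every neighbourhood, so restricting the filter to them keeps it
     proper: this filter plays the part of an escaping sequence. *)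
  pose H := filter_prod (nbhs d)
    (filter_prod (nbhs (0 : 'rV[R]_n)) (pinfty_nbhs R)).
  pose F := within (fun q => ~ P q.2 q.1) H.
  have FF : ProperFilter F.
    apply: Build_ProperFilter_ex => A FA; apply: contrapT => A0; apply: nP.
    suff : H [set q | P q.2 q.1] by [].
    have : H [set q | ~ P q.2 q.1 -> A q] by [].
    apply: filterS => q qA; apply: contrapT => nPq.
    by apply: A0; exists q; exact: qA.
  have FH : F --> H by exact: cvg_within.
  have qd : q.1 @[q --> F] --> d by move=> A dA; apply: FH; exact: cvg_fst.
  have q2 : q.2 @[q --> F] --> filter_prod (nbhs (0 : 'rV[R]_n)) (pinfty_nbhs R).
    by move=> A GA; apply: FH; exact: cvg_snd.
  have qu : q.2.1 @[q --> F] --> (0 : 'rV[R]_n).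
    by move=> A A0; apply: (q2 (fst @^-1` A)); exact: cvg_fst.
  have qt : q.2.2 @[q --> F] --> +oo 
    by move=> A Aoo; apply: (q2 (snd @^-1` A)); exact: cvg_snd.
  have qtd : (q.2.2)^-1 *: (q.2.2 *: q.1) @[q --> F] --> d.
    apply: cvg_trans qd; apply: near_eq_cvg; near=> q.
    rewrite scalerA mulVf ?scale1r// gt_eqF//; near: q; exact: cvgry_gt.
  have nearF : \forall q \near F, ~ P q.2 q.1 by exact: withinT.
  have Kd : Kq phi d.
    apply: (Kq_escape (y := y) qu qt qtd); apply: filterS nearF => q nPq.
    by rewrite leNgt; apply/negP => lt; apply: nPq.
  suff d0 : d = 0 by move: d1; rewrite d0 normr0 => /eqP; rewrite eq_sym oner_eq0.
  apply: KqX Kd; apply: (asymptotic_cone_ray (y := y)) => s s0.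
  apply: (closed_convex_escape qt qtd) => //.
  by apply: filterS nearF => q nPq; apply: contrapT => nX; apply: nPq => /nX.
exists (Num.max M 0); near=> u => x Xx; rewrite leNgt => lexy.
rewrite leNgt; apply/negP; rewrite gt_max => /andP[Mx x0].
have xE : `|x| *: (`|x|^-1 *: x) = x by rewrite scalerA divff ?scale1r ?gt_eqF.
have := UW (u, `|x|) _ (`|x|^-1 *: x); rewrite /P /= xE.
move=> H; move/negP: lexy; apply; apply: H => //.
  by split; [near: u|exact: MW].
by rewrite normrZ gtr0_norm ?invr_gt0// mulVf// gt_eqF.
Unshelve. all: by end_near. Qed.

Lemma argmin_near y : X y -> \forall u \near (0 : 'rV[R]_n),
  exists2 x, X x & forall z, X z -> phi x - dotp u x <= phi z - dotp u z.
Proof.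
move=> Xy; have [M levM] := level_bounded Xy.
apply: filterS levM => u levM; have yM : `|y| <= M by exact: levM.
have cK : compact (X `&` [set x | `|x| <= M]).
  exact: compact_truncation.
have [|x [Xx xM] minx] := lsc_argmin (@lsc_perturb u) cK; first by exists y.
exists x => // z Xz.
have [zy|yz] := leP (phi z - dotp u z) (phi y - dotp u y).
  by apply: minx; split => //; exact: levM.
by apply: le_trans (ltW yz); exact: minx.
Qed.

(** On the compact part of [X] outside [V] one has [phi y < phi], a strict
    inequality that persists near each point and for [u] near 0 by lower
    semicontinuity; the part of [X] at infinity is handled by
    [level_bounded]. *)
Lemma level_localized y (V : set 'rV[R]_n) : X y -> open V ->
  (forall x, X x -> phi x <= phi y -> V x) ->
  \forall u \near (0 : 'rV[R]_n), forall x, X x ->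
    phi x - dotp u x <= phi y - dotp u y -> V x.
Proof.
move=> Xy oV levV; have [M levM] := level_bounded Xy.
have /compact_near_coveringP cK : compact ((X `&` [set x | `|x| <= M]) `&` ~` V).
  apply: compact_closedI; first exact: compact_truncation.
  exact: open_closedC.
have away : \forall u \near (0 : 'rV[R]_n), (X `&` [set x | `|x| <= M]) `&` ~` V
    `<=` (fun x => phi y - dotp u y < phi x - dotp u x).
  apply: (cK _ (nbhs (0 : 'rV[R]_n))
    (fun u x => phi y - dotp u y < phi x - dotp u x) _).
  move=> x [[Xx _] nVx].
  have yx : phi y < phi x.
    by rewrite ltNge; apply/negP => xy; apply: nVx; exact: levV.
  pose r := (phi y + phi x) / 2.
  have rx : \forall z \near x, r < phi z by apply: lsc_near => //; rewrite /r; lra.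
  have cvg_gap : dotp q.2 q.1 - dotp q.2 y @[q --> (x, 0 : 'rV[R]_n)] --> (0 : R).
    rewrite -[X in _ --> X]subr0 -{1}(dotp0l x) -(dotp0l y).
    apply: cvgB; first by apply: cvg_dotp; [exact: cvg_snd|exact: cvg_fst].
    by apply: cvg_dotp; [exact: cvg_snd|exact: cvg_cst].
  have r0 : 0 < r - phi y by rewrite /r; lra.
  have : \forall q \near (x, 0 : 'rV[R]_n), r < phi q.1 /\
      dotp q.2 q.1 - dotp q.2 y < r - phi y.
    near=> q; split; last by near: q; exact: (cvgr_lt _ cvg_gap).
    by near: q; exact: (cvg_fst rx).
  by apply: filterS => q [rq qr]; lra.
near=> u => x Xx lexy; apply: contrapT => nVx.
have xM : `|x| <= M by move: x Xx lexy {nVx}; near: u.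
have : phi y - dotp u y < phi x - dotp u x.
  have : ((X `&` [set x | `|x| <= M]) `&` ~` V) x by [].
  by move: x {Xx lexy nVx xM}; near: u.
by rewrite ltNge lexy.
Unshelve. all: by end_near. Qed.

End RobustScalar.

(** * From components to the vector problem *)

Section Components.
Context {R : realType} {m n : nat}.
Implicit Types (f : 'rV[R]_n -> 'rV[R]_m) (u : 'M[R]_(m, n)).

Lemma perturbE f u x i : perturb f u x 0 i = f x 0 i - dotp (row i u) x.
Proof. by rewrite !mxE. Qed.

Lemma Solw_argmin (X : set 'rV[R]_n) f u i x : X x ->
  (forall z, X z -> f x 0 i - dotp (row i u) x <= f z 0 i - dotp (row i u) z) ->
  Solw X f u x.
Proof.
move=> Xx minx; split=> // -[z Xz /(_ i)].
by rewrite !perturbE ltNge minx.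
Qed.

(** The perturbation [v] of one component is extended to all rows. A level set
    of a single component need not be a level set of the map, but two points of
    it lie in the level set of the map whose bounds are the componentwise maxima
    of their values. *)
Lemma robust_component (alpha : R) f i : 0 < alpha ->
  robustly_quasiconvex alpha f ->
  \forall v \near (0 : 'rV[R]_n), quasiconvex (fun x => f x 0 i - dotp v x).
Proof.
move=> alpha0 qcf.
have small : \forall v \near (0 : 'rV[R]_n), enorm v < alpha.
  exact: (cvgr_lt _ cvg_enorm0).
apply: filterS small => v va r.
pose u : 'M[R]_(m, n) := \matrix_(j, k) (- v 0 k).
have rowu j : row j u = - v by apply/rowP => k; rewrite !mxE.
have ua : mnorm u < alpha.
  apply: bigmax_lt => // j _; by rewrite rowu /enorm dotpNl dotpNr opprK.
pose g x := f x + mdotp u x.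
have gE x j : g x 0 j = f x 0 j - dotp v x by rewrite !mxE rowu dotpNl.
apply/convex_setP => x y s /= xr yr s01.
have := (convex_setP _).1 (qcf u ua (\row_j Num.max (g x 0 j) (g y 0 j))) x y s.
rewrite -/(g _) /= => /(_ _ _ s01 i); rewrite -/(g _) gE mxE.
move=> /(_ _ _)/le_trans; apply.
- by move=> j; rewrite mxE le_max lexx.
- by move=> j; rewrite mxE le_max lexx orbT.
- by rewrite ge_max !gE xr yr.
Qed.

Lemma row_continuous i : continuous (fun u => row i u : 'rV[R]_n).
Proof.
move=> u A [B Bu sBA]; exists (fun i' j => [set r | i' = i -> B 0 j r]).
  move=> i' j; have [->|i'i] := eqVneq i' i; last first.
    apply: (@filterS _ (nbhs (u i' j)) _ setT); last exact: filterT.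
    by move=> r _ ii; move: i'i; rewrite ii eqxx.
  by have := Bu 0 j; rewrite mxE; apply: (@filterS _ (nbhs (u i j))) => r Br _.
by move=> v Bv; apply: sBA => k j; rewrite ord1 mxE; exact: Bv.
Qed.

End Components.

Theorem proposition5p2 (R : realType) (m n : nat) (m_gt0 : (0 < m)%N)
    (X : set 'rV[R]_n) (closedX : closed X) (unboundedX : ~ bounded_set X)
    (convexX : convex_set X) (alpha : R) (alpha_gt0 : 0 < alpha)
    (f : 'rV[R]_n -> 'rV[R]_m) (qcf : robustly_quasiconvex alpha f)
    (lscf : forall i, lower_semicontinuous (fun x => (f x 0 i)%:E)) :
  ((exists xbar, Solw X f 0 = [set xbar]) ->
   asymptotic_cone X `&` \bigcup_i Kq (fun x => f x 0 i) = [set 0] ->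
   setvalued_lsc_at (Solw X f) 0) /\
  (setvalued_lsc_at (Solw X f) 0 ->
   asymptotic_cone X `&` \bigcap_i Kq (fun x => f x 0 i) = [set 0]).
Proof.
split=> [[xbar Sol0] cone0|[[xbar Sxbar] lscS]].
- pose i0 := Ordinal m_gt0; pose phi x := f x 0 i0.
  have lscphi : lower_semicontinuous (EFin \o phi) := lscf i0.
  have qcphi := robust_component i0 alpha_gt0 qcf.
  have KqX d : asymptotic_cone X d -> Kq phi d -> d = 0.
    by move=> Xd Kd; have : [set 0] d by rewrite -cone0; split=> //; exists i0.
  have Xxbar : X xbar.
    have : Solw X f 0 xbar by rewrite Sol0.
    by case.
  have argmin_xbar x : X x -> (forall z, X z -> phi x <= phi z) -> x = xbar.
    move=> Xx minx; suff : Solw X f 0 x by rewrite Sol0.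
    by apply: (Solw_argmin (i := i0)) => // z Xz; rewrite row0 !dotp0l !subr0 minx.
  have argmin := argmin_near lscphi qcphi closedX convexX KqX Xxbar.
  have [z Xz minz] := nbhs_singleton argmin.
  have {}minz w : X w -> phi z <= phi w.
    by move=> /minz; rewrite !dotp0l !subr0.
  have zE := argmin_xbar z Xz minz.
  split; first by exists xbar; rewrite Sol0.
  move=> V oV [x []]; rewrite Sol0 => -> Vxbar.
  have levV x' : X x' -> phi x' <= phi xbar -> V x'.
    move=> Xx' lex'; rewrite (argmin_xbar x') // => w Xw.
    by apply: le_trans lex' _; rewrite -zE minz.
  have rowcvg : row i0 u @[u --> (0 : 'M[R]_(m, n))] --> (0 : 'rV[R]_n).
    have <- : row i0 (0 : 'M[R]_(m, n)) = 0 by exact: row0.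
    exact: row_continuous.
  have loc := level_localized lscphi qcphi closedX convexX KqX Xxbar oV levV.
  exists [set u | Solw X f u `&` V !=set0] => //.
  near=> u.
  have [y Xy miny] : exists2 x, X x & forall z, X z ->
      phi x - dotp (row i0 u) x <= phi z - dotp (row i0 u) z.
    by near: u; exact: (rowcvg _ argmin).
  exists y; split; first exact: (Solw_argmin (i := i0)).
  have := miny _ Xxbar; move: y Xy {miny}.
  by near: u; exact: (rowcvg _ loc).
- have Xxbar : X xbar by case: Sxbar.
  apply/seteqP; split=> [d [Xd Kd]|_ ->]; last first.
    split.
      by apply: (asymptotic_cone_ray (y := xbar)) => s _; rewrite scaler0 addr0.
    by move=> i _; apply/KqP => x t _; rewrite scaler0 addr0.
  apply: contrapT => /eqP d0.
  have [|U U0 SolU] := lscS _ openT; first by exists xbar.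
  pose u (e : R) : 'M[R]_(m, n) := e *: \matrix_(i, j) d 0 j.
  have rowu e i : row i (u e) = e *: d by apply/rowP => j; rewrite !mxE.
  have ucvg : u e @[e --> (0 : R)^'+] --> (0 : 'M[R]_(m, n)).
    rewrite -(scale0r (\matrix_(i, j) d 0 j)); apply: cvgZ; last exact: cvg_cst.
    exact: cvg_within.
  have [e [e0 Ue]] : exists e, 0 < e /\ U (u e).
    apply/(@filter_ex _ (0 : R)^'+); near=> e; split => //.
    by near: e; exact: ucvg.
  have [x [[Xx noX] _]] := SolU _ Ue; apply: noX; exists (x + 1 *: d).
    exact: asymptotic_cone_recession.
  move=> i; rewrite !perturbE rowu scale1r dotpDr.
  have := (KqP _ _).1 (Kd i Logic.I) x 1 ltr01; rewrite scale1r.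
  have : 0 < dotp (e *: d) d by rewrite dotpZl mulr_gt0// dotp_gt0.
  by lra.
Unshelve. all: by end_near. Qed.
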